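(* For every $A\in 2^\omega$ there is a sequence in $2^\omega$ which is both higher $A$-left-c.e. and higher $A$-ML-random. Such a sequence can be found uniformly in $A$: there is a single $\Pi^1_1$ set $W\subseteq 2^{<\omega}\times 2^{<\omega}$ such that for every $A\in 2^\omega$ there is a higher $A$-ML-random sequence $X\in 2^\omega$ with $W^A=\{\sigma\in 2^{<\omega}:\sigma<X\}$.
   Context: For $A\in 2^\omega$ and $W\subseteq 2^{<\omega}\times 2^{<\omega}$ let $W^A=\{\sigma : (\exists \tau\prec A)\ (\tau,\sigma)\in W\}$, where $\tau\prec A$ means that $\tau$ is a finite initial segment of $A$. A set of strings is higher $A$-c.e. if it equals $W^A$ for some $\Pi^1_1$ (lightface, no oracle) set $W\subseteq 2^{<\omega}\times 2^{<\omega}$. For $\sigma\in 2^{<\omega}$ and $X\in 2^\omega$, $\sigma<X$ means that $\sigma$ is lexicographically to the left of $X$: for some $n<|\sigma|$, $\sigma$ and $X$ agree below $n$ and $\sigma(n)<X(n)$. $X$ is higher $A$-left-c.e. if $\{\sigma\in 2^{<\omega}:\sigma<X\}$ is higher $A$-c.e. For $V\subseteq 2^{<\omega}$ let $[V]^\prec=\{X\in 2^\omega : (\exists\sigma\prec X)\ \sigma\in V\}$. A sequence $\langle \mathcal{U}_n\rangle_{n<\omega}$ of subsets of $2^\omega$ is uniformly higher $A$-c.e. open if there is a single $\Pi^1_1$ set $U\subseteq\omega\times 2^{<\omega}\times 2^{<\omega}$ with $\mathcal{U}_n=[U_n^A]^\prec$ for all $n$, where $U_n=\{(\tau,\sigma):(n,\tau,\sigma)\in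 U\}$. $\lambda$ is the fair-coin measure on $2^\omega$. A higher $A$-ML-test is a uniformly higher $A$-c.e. open sequence $\langle\mathcal{U}_n\rangle$ with $\lambda(\mathcal{U}_n)\leq 2^{-n}$ for all $n$. $X\in 2^\omega$ is higher $A$-ML-random if $X\notin\bigcap_n\mathcal{U}_n$ for every higher $A$-ML-test $\langle\mathcal{U}_n\rangle$. *)

(* Defs.v *)
From mathcomp Require Import all_boot all_order all_algebra.
From mathcomp Require Import all_classical all_reals all_analysis.

Set Implicit Arguments.
Unset Strict Implicit.
Unset Printing Implicit Defensive.

Import Order.TTheory GRing.Theory Num.Theory.

Local Open Scope classical_set_scope.
Local Open Scope ring_scope.

(* 2^<omega is [seq bool]; 2^omega is the library's [cantor_space], which is
   convertible to [nat -> bool]. *)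

(** * Lightface Pi^1_1 sets *)

(* Arithmetical formulas of the language of second-order arithmetic with a
   single, unquantified set variable.  Number variables are de Bruijn indices;
   the remaining connectives, the existential quantifier and < are definable. *)
Inductive aterm : Type :=
  | TVar of nat
  | TZero
  | TSucc of aterm
  | TAdd of aterm & aterm
  | TMul of aterm & aterm.

Inductive aform : Type :=
  | FEq of aterm & aterm
  | FMem of aterm
  | FNot of aform
  | FAnd of aform & aform
  | FAll of aform.

Fixpoint teval (v : seq nat) (t : aterm) : nat :=
  match t with
  | TVar i => nth 0%N v i
  | TZero => 0%N
  | TSucc t => (teval v t).+1
  | TAdd t u => (teval v t + teval v u)%N
  | TMul t u => (teval v t * teval v u)%N
  end.

Fixpoint holds (Z : set nat) (v : seq nat) (f : aform) : Prop :=
  match f with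
  | FEq t u => teval v t = teval v u
  | FMem t => Z (teval v t)
  | FNot f => ~ holds Z v f
  | FAnd f g => holds Z v f /\ holds Z v g
  | FAll f => forall n : nat, holds Z (n :: v) f
  end.

(* [S] is defined, without parameters, by "for all Z, f" with [f] arithmetical,
   the elements of [T] being coded by tuples of numbers through [code]. *)
Definition pi11 (T : Type) (code : T -> seq nat) (S : set T) : Prop :=
  exists f : aform,
    forall t : T, S t <-> forall Z : set nat, holds Z (code t) f.

(* Bijective base-2 numeration, least significant digit first: a computable
   bijection from 2^<omega onto omega. *)
Definition strcode (s : seq bool) : nat :=
  foldr (fun (b : bool) m => (m.*2 + b.+1)%N) 0%N s.

Definition code2 (p : seq bool * seq bool) : seq nat :=
  [:: strcode p.1; strcode p.2].

Definition code3 (q : nat * (seq bool * seq bool)) : seq nat :=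
  q.1 :: code2 q.2.

(** * Higher relative computable enumerability *)

Definition init_seg (s : seq bool) (X : cantor_space) : Prop :=
  s = mkseq X (size s).

Definition relativize (W : set (seq bool * seq bool)) (A : cantor_space) :
    set (seq bool) :=
  [set s | exists t, init_seg t A /\ W (t, s)].

Definition higher_ce (A : cantor_space) (V : set (seq bool)) : Prop :=
  exists W, pi11 code2 W /\ V = relativize W A.

Definition lex_left (s : seq bool) (X : cantor_space) : Prop :=
  exists n : nat, [/\ (n < size s)%N,
    forall i, (i < n)%N -> nth false s i = X i &
    nth false s n = false /\ X n = true].

Definition higher_left_ce (A X : cantor_space) : Prop :=
  higher_ce A [set s | lex_left s X].

Definition open_of (V : set (seq bool)) : set cantor_space :=
  [set X | exists s, init_seg s X /\ V s].

Definition unif_higher_ce_open (A : cantor_space)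
    (U : nat -> set cantor_space) : Prop :=
  exists V : set (nat * (seq bool * seq bool)),
    pi11 code3 V /\
    forall n, U n = open_of (relativize [set p | V (n, p)] A).

(** * Fair-coin measure and randomness *)

(* The Caratheodory outer measure induced by the weights 2^-|s| of the basic
   clopen sets; it is the fair-coin measure on Borel sets. *)
Definition fair_coin (R : realType) (U : set cantor_space) : \bar R :=
  ereal_inf [set (\sum_(0 <= k <oo) (2 ^- size (s k))%:E)%E |
             s in [set s : nat -> seq bool |
                   U `<=` \bigcup_k open_of [set s k]]].

Definition higher_ML_test (R : realType) (A : cantor_space)
    (U : nat -> set cantor_space) : Prop :=
  unif_higher_ce_open A U /\
  forall n, (fair_coin R (U n) <= (2 ^- n)%:E)%E.

Definition higher_ML_random (R : realType) (A X : cantor_space) : Prop :=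
  forall U, higher_ML_test R A U -> ~ (\bigcap_n U n) X.

(* Main.v *)
(* The index of a test is the code [e] of the formula defining it, and only its
   component [e + 1] is used.  Among the strings of length [m] the index [e] may
   claim at most [2 ^ (m - e - 1)] that lie in that component; as these bounds
   add up to less than [2 ^ m], the claimed strings can never exhaust level [m].
   Let [X] be the supremum of the strings [s] such that all strings of the length
   of [s] to the left of [s] can be claimed.  If the component really has measure
   at most [2 ^ - (e + 1)], then its index can claim any string of it that is not
   claimed yet, so a cylinder of the component around [X] would push the supremum
   to the right of [X].  An index whose component is too large is merely cut off
   by its bound, which needs no knowledge of the measure relative to the oracle.

   The left cut of [X] is Pi^1_1: a string is in it iff it belongs to every set
   [Y] closed under rules which evaluate formulas and enumerate claims.  The rules
   evaluate formulas at base sets [Z_i] contained in [Y], one for each instance [i]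
   of a formula, so that a single quantifier over [Y] serves all the instances
   which the claims involve. *)

Require Import Defs.
From mathcomp Require Import all_boot all_order all_algebra.
From mathcomp Require Import all_classical all_reals all_analysis.
From mathcomp Require Import zify.

Set Implicit Arguments.
Unset Strict Implicit.
Unset Printing Implicit Defensive.

Import Order.TTheory GRing.Theory Num.Theory.

Local Open Scope classical_set_scope.
Local Open Scope nat_scope.

(** * Lexicographic order and suprema *)

Fixpoint lexlt (s t : seq bool) : bool :=
  match s, t with
  | b :: s', c :: t' => (~~ b && c) || ((b == c) && lexlt s' t')
  | _, _ => false
  end.

Lemma lexlt_catl s t u : lexlt s t -> lexlt (s ++ u) t.
Proof.
elim: s t => [|b s IH] [|c t] //= /orP[->//|/andP[-> /IH->]].
by rewrite orbT.
Qed.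

Lemma lexlt_trans : transitive lexlt.
Proof.
move=> t s u; elim: s t u => [|b s IH] [|c t] [|d u] //=.
case: b c d => [] [] [] //=; exact: IH.
Qed.

Lemma lexlt_total s t : size s = size t -> s != t -> lexlt s t || lexlt t s.
Proof.
elim: s t => [|b s IH] [|c t] //=.
by case=> sz; rewrite eqseq_cons; case: b c => [] [] //= /(IH _ sz).
Qed.

Lemma lexlt_rcons s t b c : size s = size t ->
  lexlt (rcons s b) (rcons t c) = lexlt s t || [&& s == t, ~~ b & c].
Proof.
elim: s t => [|b' s IH] [|c' t] //=; first by rewrite andbF orbF.
by case=> sz; rewrite (IH _ sz) eqseq_cons; case: b' c' => [] [].
Qed.

Lemma lexlt_rcons_true s t : lexlt (rcons s true) t -> lexlt s t.
Proof. by elim: s t => [|[] s IH] [|[] t] //= /IH. Qed.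

Lemma lexlt_rcons_false s t :
  lexlt (rcons s false) t -> lexlt s t \/ prefix (rcons s true) t.
Proof.
elim: s t => [|b s IH] [|c t] //=.
  by case: c; rewrite ?prefix0s; [right|].
by case: b c => [] [] //=; [apply: IH | left | apply: IH].
Qed.

Lemma mkseq_cons T (X : nat -> T) n :
  mkseq X n.+1 = X 0 :: mkseq (X \o S) n.
Proof. by rewrite /mkseq /= -[1]addn0 iotaDl -map_comp. Qed.

Lemma lex_leftE s X : lex_left s X <-> lexlt s (mkseq X (size s)).
Proof.
elim: s X => [|b s IH] X; first by split => // -[n []].
rewrite [size _]/= mkseq_cons /=; split.
  case=> -[|n] [ns eqX [sn Xn]]; first by move: sn Xn => /= -> ->.
  have /= -> := eqX 0 isT; rewrite eqxx /=.
  apply/orP; right; apply/IH; exists n; split=> // i ltin.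
  exact: (eqX i.+1).
case/orP=> [/andP[bF X0]|/andP[/eqP b0 /IH[n [ns eqX [sn Xn]]]]].
  by exists 0; split=> //; split => //; apply: negbTE.
by exists n.+1; split=> // -[|i] //= ltin; apply: eqX.
Qed.

Section Supremum.
Variable S : set (seq bool).

Let C s := exists2 t, S t & lexlt s t.

(** Greedy construction: as the segment built so far is never in [C], its next digit is 1 exactly
    when a member of [S] extends the segment followed by 1. *)
Fixpoint sup_seg n : seq bool :=
  if n is n'.+1 then rcons (sup_seg n') `[< C (rcons (sup_seg n') false) >]
  else [::].

Definition lex_sup : cantor_space :=
  fun n => `[< C (rcons (sup_seg n) false) >].

Lemma size_sup_seg n : size (sup_seg n) = n.
Proof. by elim: n => //= n IH; rewrite size_rcons IH. Qed.

Lemma mkseq_lex_sup n : mkseq lex_sup n = sup_seg n.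
Proof. by elim: n => // n IH; rewrite mkseqS IH. Qed.

Lemma sup_seg_notin n : ~ C (sup_seg n).
Proof.
elim: n => [[]//|n IH] /=; case: asboolP => // _ -[t St] /lexlt_rcons_true.
by move=> lt_t; apply: IH; exists t.
Qed.

Lemma lex_left_sup s : lex_left s lex_sup <-> C s.
Proof.
rewrite lex_leftE mkseq_lex_sup; split.
  elim/last_ind: s => [//|s b IH]; rewrite size_rcons /=.
  rewrite lexlt_rcons ?size_sup_seg// => /orP[/IH [t St lt_t]|].
    by exists t => //; rewrite -cats1 lexlt_catl.
  by case/and3P=> /eqP eqs /negbTE-> /asboolP; rewrite -eqs.
move=> Cs; have := @lexlt_total s (sup_seg (size s)).
rewrite size_sup_seg => /(_ erefl).
case: eqP => [eqs|_ /(_ isT)/orP[//|gt_s]].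
  by case: (@sup_seg_notin (size s)); rewrite -eqs.
have [t St lt_t] := Cs; case: (@sup_seg_notin (size s)).
by exists t => //; apply: lexlt_trans lt_t.
Qed.

(* The members of [S] can be lengthened, hence one passes through any initial
   segment of the supremum. *)
Lemma prefix_sup_seg n : (exists t, S t) ->
  (forall t, S t -> S (rcons t false)) ->
  exists2 t, S t & prefix (sup_seg n) t.
Proof.
move=> [t0 St0] S0.
have long t m : S t -> exists k, S (t ++ nseq k false) /\ m < size t + k.
  move=> St; exists m.+1; split; last by rewrite addnS ltnS leq_addl.
  elim: m.+1 => [|k IH]; first by rewrite cats0.
  by rewrite -addn1 nseqD catA cats1; apply: S0.
elim: n => [|n [t St pt]]; first by exists t0 => //; rewrite prefix0s.
have nC := @sup_seg_notin n; rewrite /=.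
case: asboolP => [[u Su]|nC0].
  by case/lexlt_rcons_false => [lt_u|]; [case: nC; exists u | exists u].
have [k [Stk lt_n]] := long t n St.
exists (t ++ nseq k false) => //.
have := prefix_catl (nseq k false) pt; case/prefixP => -[|c u] eq_t.
  move: lt_n; rewrite -[k in size t + k](size_nseq k false) -size_cat eq_t.
  by rewrite cats0 size_sup_seg ltnn.
case: c eq_t => eq_t; last by rewrite eq_t -cats1 prefix_catr//= eqxx prefix0s.
case: nC0; exists (t ++ nseq k false) => //; rewrite eq_t -cats1.
by elim: (sup_seg n) => //= b s ->; rewrite eqxx orbT.
Qed.
End Supremum.

(** * Claiming strings from the left *)

(** Binary successor, most significant digit first; the boolean is the carry out, raised only on
    strings of ones. *)
Fixpoint incr (s : seq bool) : bool * seq bool :=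
  if s is b :: s' then
    let: (c, t) := incr s' in if c then (b, ~~ b :: t) else (false, b :: t)
  else (true, [::]).

Fixpoint budget m : seq nat := if m is m'.+1 then 2 ^ m' :: budget m' else [::].

(* All strings of the length of [s] to the left of [s] are claimed by indices
   which [O] allows, and [B] is what the bounds leave for further claims. *)
Inductive covers (O : nat -> seq bool -> Prop) : seq bool -> seq nat -> Prop :=
  | covers_nil m : covers O (nseq m false) (budget m)
  | covers_step s t B e : covers O s (incr_nth B e) -> e < size B -> O e s ->
      incr s = (false, t) -> covers O t B.

Fixpoint binval (s : seq bool) : nat :=
  if s is b :: s' then b * 2 ^ size s' + binval s' else 0.

Lemma incrP s : let: (c, t) := incr s in
  size t = size s /\ (binval s).+1 = binval t + c * 2 ^ size s.
Proof.
elim: s => [|b s] //=; case: (incr s) => [[] t] [sz E] /=.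
  by rewrite sz expnS; split=> //; case: b => /=; lia.
by rewrite sz; split=> //; lia.
Qed.

Lemma incr_lexlt s t : incr s = (false, t) -> lexlt s t.
Proof.
elim: s t => [|b s IH] t //=; case: (incr s) IH => [[] u] IH [].
  by move=> -> <-.
by move=> <- /=; rewrite eqxx IH ?orbT.
Qed.

Lemma incr_rcons_false s : incr (rcons s false) = (false, rcons s true).
Proof. by elim: s => //= b s ->. Qed.

Lemma incr_rcons_true s :
  incr (rcons s true) = ((incr s).1, rcons (incr s).2 false).
Proof. by elim: s => //= b s ->; case: (incr s) => [[] t]. Qed.

Lemma prefix_binval_lt s t u : size t = size u -> prefix s t ->
  lexlt t u -> ~~ prefix s u -> lexlt s u.
Proof.
elim: s t u => [|b s IH] [|c t] [|d u] //= [sz] /andP[/eqP<- pst].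
by case: b d => [] [] //= /(IH _ _ sz pst).
Qed.

Lemma size_budget m : size (budget m) = m.
Proof. by elim: m => //= m ->. Qed.

Lemma nth_budget m e : e < m -> nth 0 (budget m) e = 2 ^ (m - e.+1).
Proof.
elim: m e => // m IH [|e] /=; first by rewrite subn1.
by rewrite subSS ltnS; apply: IH.
Qed.

Lemma sumn_budget m : (sumn (budget m)).+1 = 2 ^ m.
Proof. by elim: m => //= m IH; rewrite -addnS IH addnn -mul2n expnS. Qed.

Lemma sumn_incr_nth B e : sumn (incr_nth B e) = (sumn B).+1.
Proof.
elim: B e => [|x B IH] [|e] //=; last by rewrite IH addnS.
by elim: e => //= e ->.
Qed.

Lemma budget_double m : budget m.+1 = rcons (map double (budget m)) 1.
Proof. by elim: m => //= m <-; rewrite expnS mul2n. Qed.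

Lemma double_incr_nth B e : e < size B ->
  rcons (map double (incr_nth B e)) 1 =
  incr_nth (incr_nth (rcons (map double B) 1) e) e.
Proof. by elim: B e => [|x B IH] [|e] //= ltB; rewrite IH. Qed.

Section Covers.
Variable O : nat -> seq bool -> Prop.
Hypothesis O_rcons : forall e s b, O e s -> O e (rcons s b).

(** Every claimed string splits into two claimed children, so the entries double; the new level adds
    one index, with bound 1. *)
Lemma covers_rcons s B : covers O s B ->
  covers O (rcons s false) (rcons (map double B) 1).
Proof.
elim=> [m|{}s t {}B e _ IH eB Oes s_t].
  rewrite -budget_double -cats1 (_ : [:: false] = nseq 1 false)// -nseqD addn1.
  exact: covers_nil.
have sz : e < size (rcons (map double B) 1).
  by rewrite size_rcons size_map (ltn_trans eB).
move: IH; rewrite (double_incr_nth eB) => IH.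
have st := incr_rcons_false s.
apply: (@covers_step _ (rcons s true) _ _ e) => //; last 2 first.
- exact: O_rcons.
- by rewrite incr_rcons_true s_t.
apply: (covers_step IH) => //; last exact: O_rcons.
by rewrite size_incr_nth sz.
Qed.

Lemma covers_size s B : covers O s B -> size B = size s.
Proof.
elim=> [m|{}s t {}B e _ IH eB _ s_t]; first by rewrite size_nseq size_budget.
have := incrP s; rewrite s_t => -[-> _].
by rewrite -IH size_incr_nth eB.
Qed.

Lemma covers_sumn s B : covers O s B -> (sumn B + binval s).+1 = 2 ^ size s.
Proof.
elim=> [m|{}s t {}B e _ IH eB _ s_t].
  rewrite size_nseq (_ : binval _ = 0) ?addn0 ?sumn_budget//.
  by elim: m.
have := incrP s; rewrite s_t => -[-> ]; rewrite mul0n addn0 => <-.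
by rewrite -IH sumn_incr_nth addnS.
Qed.

(** [D] collects the claims of [e], one for each unit spent from its entry. *)
Lemma covers_used s B e : covers O s B -> e < size s ->
  exists D : seq (seq bool), [/\ uniq D,
    forall t, t \in D -> [/\ size t = size s, O e t & binval t < binval s] &
    size D + nth 0 B e = 2 ^ (size s - e.+1)].
Proof.
elim=> [m|{}s t {}B d _ IH dB Ods s_t].
  rewrite size_nseq => em; exists [::]; split=> //.
  by rewrite nth_budget.
have := incrP s; rewrite s_t mul0n addn0 => -[szt vt].
rewrite szt -vt => /IH[D [uD OD szD]].
move: szD; rewrite nth_incr_nth; case: eqP => [eqde|_] szD; last first.
  exists D; split=> // u /OD[? ? ltu]; split=> //; exact: ltnW.
exists (s :: D); split.
- rewrite /= uD andbT; apply/negP => /OD[_ _]; by rewrite ltnn.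
- move=> u; rewrite inE => /predU1P[->|/OD[? ? ltu]]; split=> //.
    by rewrite -eqde.
  exact: ltnW.
- by rewrite -szD /= addSnnS.
Qed.

Lemma O_prefix e s t : prefix s t -> O e s -> O e t.
Proof.
move=> /prefixP[u ->]; elim/last_ind: u => [|u b IH]; first by rewrite cats0.
by rewrite -rcons_cat => /IH; apply: O_rcons.
Qed.

(** While the covered string extends [r], index [e] can claim it and the cover advances. Each claim
    costs a unit of the budget, so the string eventually leaves the cylinder of [r], to the
    right. *)
Lemma covers_escape e s B r :
  (forall m D, uniq D -> (forall t, t \in D -> size t = m /\ O e t) ->
    size D * 2 ^ e.+1 <= 2 ^ m) ->
  covers O s B -> e < size s -> prefix r s -> O e r ->
  exists t, (exists C, covers O t C) /\ lexlt r t.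
Proof.
move=> small; move eqn: (sumn B) => n.
elim/ltn_ind: n s B eqn => n IH s B eqn covB es prs Or.
have Os := O_prefix prs Or.
have [D [uD OD szD]] := covers_used covB es.
have lt0 : 0 < nth 0 B e.
  rewrite lt0n; apply/eqP => nth0.
  have := small (size s) (s :: D); rewrite /= uD andbT.
  have -> : s \notin D by apply/negP => /OD[_ _]; rewrite ltnn.
  have sD t : t \in s :: D -> size t = size s /\ O e t.
    by rewrite inE => /predU1P[->//|/OD[]].
  move: szD; rewrite nth0 addn0 => -> /(_ isT sD).
  by rewrite leqNgt mulSn -expnD subnK// -[X in X < _]add0n ltn_add2r expn_gt0.
have eB : e < size B by rewrite (covers_size covB).
pose B' := set_nth 0 B e (nth 0 B e).-1.
have szB' : size B' = size B by rewrite size_set_nth; apply/maxn_idPr.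
have eqB : B = incr_nth B' e.
  apply: (@eq_from_nth _ 0); first by rewrite size_incr_nth szB' eB.
  move=> i _; rewrite nth_incr_nth nth_set_nth /= eq_sym.
  by case: eqP => [->|//]; rewrite add1n prednK.
move: covB lt0; rewrite {1}eqB => covB lt0.
case eqt: (incr s) => [c t].
have := incrP s; rewrite eqt => -[szt vt].
(* A carry would make [s] the last string of its level, with no budget left, but the entry of [e] is
   positive. *)
case: c eqt vt => eqt vt.
  by have := covers_sumn covB; move: vt; rewrite sumn_incr_nth mul1n; lia.
have covt : covers O t B'.
  by apply: (covers_step covB); rewrite ?szB'.
case: (boolP (prefix r t)) => prt; last first.
  exists t; split; first by exists B'.
  exact: (prefix_binval_lt (esym szt) prs (incr_lexlt eqt) prt).
apply: (IH (sumn B')) prt Or => //; last by rewrite szt.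
by rewrite -eqn eqB sumn_incr_nth.
Qed.

Lemma lex_sup_avoids e n :
  (forall m D, uniq D -> (forall t, t \in D -> size t = m /\ O e t) ->
    size D * 2 ^ e.+1 <= 2 ^ m) ->
  ~ O e (mkseq (lex_sup [set s | exists B, covers O s B]) n).
Proof.
set S := [set s | _] => small; rewrite mkseq_lex_sup => On.
have S0 t : S t -> S (rcons t false).
  by case=> B /covers_rcons; exists (rcons (map double B) 1).
have S_ex : exists t, S t by exists [::], [::]; apply: (covers_nil O 0).
(* The segment is lengthened beyond [e] so that the budget has an entry for [e]. *)
have {On} ON : O e (sup_seg S (n + e.+1)).
  apply: O_prefix On; elim: (e.+1) => [|k IH].
    by rewrite addn0 prefix_refl.
  by rewrite addnS; apply: (prefix_trans IH); apply: prefix_rcons.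
have [s [B covB] ps] := prefix_sup_seg (n + e.+1) S_ex S0.
have es : e < size s.
  have := size_prefix ps; rewrite size_sup_seg; apply: leq_trans.
  exact: leq_addl.
have [t [St lt_t]] := covers_escape small covB es ps ON.
by case: (@sup_seg_notin S (n + e.+1)); exists t.
Qed.
End Covers.

(** * Fair-coin measure *)

Section FairCoin.
Variable R : realType.
Local Open Scope ring_scope.

(* The fair-coin measure of the intersection of the cylinders of [s] and [t]. *)
Fixpoint cap_measure (s t : seq bool) : R :=
  match s, t with
  | [::], _ => 2 ^- size t
  | _, [::] => 2 ^- size s
  | b :: s', c :: t' => if b == c then cap_measure s' t' / 2 else 0
  end.

Lemma exprVS_half n : 2 ^- n.+1 + 2 ^- n.+1 = 2 ^- n :> R.
Proof. by rewrite exprS invfM mulrC -splitr. Qed.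

Lemma cap_measure_ge0 s t : 0 <= cap_measure s t.
Proof.
elim: s t => [|b s IH] [|c t] //=; rewrite ?invr_ge0 ?exprn_ge0//.
by case: ifP => // _; rewrite divr_ge0.
Qed.

Lemma cap_measure_split s t :
  cap_measure s t =
  cap_measure (rcons s false) t + cap_measure (rcons s true) t.
Proof.
elim: s t => [|b s IH] [|c t]; rewrite ?[LHS]/=.
- by rewrite /= exprVS_half.
- by case: c => /=; rewrite ?addr0 ?add0r exprS invfM mulrC; case: t.
- by rewrite /= !size_rcons exprVS_half.
- by rewrite /= IH; case: ifP => _; rewrite ?addr0// mulrDl.
Qed.

Lemma cap_measure_prefix s t : prefix t s -> cap_measure s t = 2 ^- size s.
Proof.
elim: s t => [|b s IH] [|c t] //= /andP[/eqP-> /IH->].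
by rewrite eqxx exprS invfM mulrC.
Qed.

Lemma cap_measure_disjoint s t : (size t <= size s)%N -> ~~ prefix t s ->
  cap_measure s t = 0.
Proof.
elim: s t => [|b s IH] [|c t] //= sz; rewrite eq_sym.
by case: eqP => //= _ /(IH _ sz)->; rewrite mul0r.
Qed.

(** Distinct strings of length [m] have disjoint cylinders, and only that of [take m s] meets the
    cylinder of [s]. *)
Lemma sum_cap_measure_le D m s : uniq D -> (forall t, t \in D -> size t = m) ->
  (m <= size s)%N -> \sum_(t <- D) cap_measure s t <= 2 ^- size s.
Proof.
move=> uD szD ms.
have szt : size (take m s) = m by rewrite size_takel.
have nprefix t : t \in D -> t != take m s -> cap_measure s t = 0.
  move=> tD neq; rewrite cap_measure_disjoint ?(szD t)//.
  by rewrite prefixE (szD t)// eq_sym.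
case: (boolP (take m s \in D)) => [sD|sD].
  rewrite (bigD1_seq (take m s))//= big_seq_cond big1 ?addr0.
    by rewrite cap_measure_prefix ?prefix_take.
  by move=> t /andP[tD neq]; apply: nprefix.
rewrite big_seq big1 ?invr_ge0 ?exprn_ge0// => t tD.
by apply: nprefix => //; apply: contraNneq sD => <-.
Qed.

(* Compactness: if the inequality failed for all [K], it would fail locally
   along the whole [path], which however lies in a cylinder [u k]. *)
Lemma sum_weight_ge (D : seq (seq bool)) m (u : nat -> seq bool) :
  uniq D -> (forall t, t \in D -> size t = m) ->
  (forall X, open_of [set t | t \in D] X -> exists k, init_seg (u k) X) ->
  exists K, (size D)%:R / 2 ^+ m <= \sum_(k < K) 2 ^- size (u k) :> R.
Proof.
move=> uD szD cov; apply: contrapT => noK.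
pose bad s := forall K,
  \sum_(k < K) cap_measure s (u k) < \sum_(t <- D) cap_measure s t.
have bad0 : bad [::].
  move=> K; rewrite ltNge; apply/negP => leK; apply: noK; exists K.
  move: leK; rewrite (_ : \sum_(t <- D) _ = (size D)%:R / 2 ^+ m).
    by under eq_bigr => k _ do rewrite [cap_measure _ _]/=.
  rewrite big_seq (eq_bigr (fun=> 2 ^- m)) => [|t /szD<-//].
  by rewrite -big_seq big_const_seq count_predT iter_addr_0 mulr_natl.
have bad_child s : bad s -> ~ bad (rcons s true) -> bad (rcons s false).
  move=> bad_s /existsNP[K1 /negP]; rewrite -leNgt => ge1 K0.
  rewrite ltNge; apply/negP => ge0.
  pose K := maxn K0 K1.
  have mono b K' : (K' <= K)%N ->
      \sum_(k < K') cap_measure (rcons s b) (u k) <=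
      \sum_(k < K) cap_measure (rcons s b) (u k).
    move=> leK.
    rewrite (big_ord_widen K (fun k => cap_measure (rcons s b) (u k)))//.
    rewrite big_mkcond; apply: ler_sum => k _; case: ifP => // _.
    exact: cap_measure_ge0.
  have := bad_s K; rewrite ltNge => /negP; apply.
  under eq_bigr => t _ do rewrite cap_measure_split.
  under [leRHS]eq_bigr => k _ do rewrite cap_measure_split.
  rewrite !big_split; apply: lerD.
    exact: le_trans ge0 (mono _ _ (leq_maxl _ _)).
  exact: le_trans ge1 (mono _ _ (leq_maxr _ _)).
pose fix path n :=
  if n is n'.+1 then rcons (path n') `[< bad (rcons (path n') true) >]
  else [::].
pose X : cantor_space := fun n => `[< bad (rcons (path n) true) >].
have pathE n : mkseq X n = path n by elim: n => // n IH; rewrite mkseqS IH.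
have sz_path n : size (path n) = n by rewrite -pathE size_mkseq.
have seg_path n : init_seg (path n) X by rewrite /init_seg sz_path pathE.
have bad_path n : bad (path n).
  elim: n => // n IH /=; case: asboolP => // nbad; exact: bad_child.
have : open_of [set t | t \in D] X.
  exists (path m); split; first exact: seg_path.
  apply: contrapT => /= /negP nD; have := bad_path m 0%N.
  rewrite big_ord0 big_seq big1 ?ltxx// => t tD.
  rewrite cap_measure_disjoint ?sz_path ?(szD t)//.
  rewrite prefixE take_oversize ?sz_path ?(szD t)//.
  by apply: contraNneq nD => ->.
move=> /cov[k uX].
(* At this depth the cylinder of [path n] lies in that of [u k], so the term of [u k] alone has its
   full measure, which [D] cannot exceed. *)
pose n := maxn m (size (u k)).
have := bad_path n k.+1; rewrite big_ord_recr /= ltNge => /negP; apply.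
rewrite [X in _ <= _ + X]cap_measure_prefix; last first.
  rewrite uX prefixE size_mkseq -pathE /n -(subnKC (leq_maxr m (size (u k)))).
  by rewrite /mkseq iotaD map_cat take_size_cat// size_map size_iota.
apply: (@le_trans _ _ (2 ^- size (path n))).
  by apply: (sum_cap_measure_le uD szD); rewrite sz_path leq_maxl.
rewrite lerDr; apply: sumr_ge0 => i _; exact: cap_measure_ge0.
Qed.

(** The outer measure is an infimum over countable covers; each cover of [U] also covers the
    cylinders of [D], so [sum_weight_ge] bounds its weight from below. *)
Lemma fair_coin_count (U : set cantor_space) (D : seq (seq bool)) m n :
  (fair_coin R U <= (2 ^- n)%:E)%E -> uniq D ->
  (forall t, t \in D -> size t = m) -> open_of [set t | t \in D] `<=` U ->
  (size D * 2 ^ n <= 2 ^ m)%N.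
Proof.
move=> leU uD szD DU.
have : (((size D)%:R / 2 ^+ m)%:E <= fair_coin R U)%E.
  apply: le_ereal_inf_tmp => _ [u Uu <-].
  have cov X : open_of [set t | t \in D] X -> exists k, init_seg (u k) X.
    by move=> /DU/Uu[k _ [s [sX eq_s]]]; exists k; rewrite -eq_s.
  have [K] := sum_weight_ge uD szD cov; rewrite -lee_fin => /le_trans; apply.
  rewrite -(big_mkord xpredT (fun k => 2 ^- size (u k))) -sumEFin.
  apply: nneseries_lim_ge => k _ _.
  by rewrite lee_fin invr_ge0 exprn_ge0.
move=> /le_trans /(_ leU); rewrite lee_fin ler_pdivrMr ?exprn_gt0//.
rewrite mulrC ler_pdivlMr ?exprn_gt0//.
by rewrite -!natrX -natrM ler_nat.
Qed.
End FairCoin.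

(** * Coding *)

(* A polynomial injection, hence given by a term; it never takes the value 0. *)
Definition npair x y := (x + y) * (x + y) + x + 1.

Lemma npair_inj x y x' y' : npair x y = npair x' y' -> x = x' /\ y = y'.
Proof.
rewrite /npair => eq_pr.
(* The code less 1 lies between the squares of [x + y] and [x + y + 1], so it determines the sum. *)
have sum_le a b c d : npair a b = npair c d -> a + b <= c + d.
  by rewrite /npair leqNgt => eq_abcd; apply/negP; nia.
have eq_sum : x + y = x' + y'.
  by apply/eqP; rewrite eqn_leq !sum_le.
by move: eq_pr; rewrite eq_sum; lia.
Qed.

Fixpoint enc (l : seq nat) : nat :=
  if l is x :: l' then npair x (enc l') else 0.

Lemma enc_cons x l : enc (x :: l) = npair x (enc l). Proof. by []. Qed.

Lemma enc_inj : injective enc.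
Proof.
elim=> [|x l IH] [|y k] //=; first by rewrite /npair addn1.
  by rewrite /npair addn1.
by move/npair_inj=> [-> /IH->].
Qed.

Lemma npair_enc x n l : npair x n = enc l -> exists2 k, l = x :: k & n = enc k.
Proof.
case: l => [|y k]; first by rewrite /npair addn1.
by move/npair_inj => [-> ->]; exists k.
Qed.

Arguments enc : simpl never.
(* Otherwise unification would compare codes by evaluating them. *)
Opaque npair enc.

Fixpoint tcode (t : aterm) : nat :=
  match t with
  | TVar i => enc [:: 0; i]
  | TZero => enc [:: 1]
  | TSucc t => enc [:: 2; tcode t]
  | TAdd t u => enc [:: 3; tcode t; tcode u]
  | TMul t u => enc [:: 4; tcode t; tcode u]
  end.

Fixpoint fcode (f : aform) : nat :=
  match f with
  | FEq t u => enc [:: 0; tcode t; tcode u]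
  | FMem t => enc [:: 1; tcode t]
  | FNot f => enc [:: 2; fcode f]
  | FAnd f g => enc [:: 3; fcode f; fcode g]
  | FAll f => enc [:: 4; fcode f]
  end.

Lemma tcode_inj : injective tcode.
Proof.
elim=> [i||t IHt|t IHt u IHu|t IHt u IHu] [j||t'|t' u'|t' u'] //= /enc_inj //.
- by case=> ->.
- by case=> /IHt->.
- by case=> /IHt-> /IHu->.
- by case=> /IHt-> /IHu->.
Qed.

Lemma fcode_inj : injective fcode.
Proof.
elim=> [t u|t|f IHf|f IHf g IHg|f IHf] [t' u'|t'|f'|f' g'|f'] //= /enc_inj //.
- by case=> /tcode_inj-> /tcode_inj->.
- by case=> /tcode_inj->.
- by case=> /IHf->.
- by case=> /IHf-> /IHg->.
- by case=> /IHf->.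
Qed.

Lemma strcode_inj : injective strcode.
Proof.
elim=> [|b s IH] [|c t] //=; rewrite -?/(strcode _) ?addnS//.
move=> eq_st; have [eqb /IH->] : b = c /\ strcode s = strcode t.
  by case: b c eq_st => [] []; lia.
by rewrite eqb.
Qed.

Lemma strcode_surj n : exists s, strcode s = n.
Proof.
elim/ltn_ind: n => -[|n] IH; first by exists [::].
have [s eq_s] := IH n./2 ltac:(lia).
exists (odd n :: s); rewrite /= -/(strcode s) eq_s addnS addnC.
by rewrite odd_double_half.
Qed.

Definition strdec n : seq bool := sval (cid (strcode_surj n)).

Lemma strdecK : cancel strdec strcode.
Proof. by move=> n; rewrite /strdec; case: cid. Qed.

Lemma strcodeK : cancel strcode strdec.
Proof. by move=> s; apply: strcode_inj; rewrite strdecK. Qed.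

Lemma strdec0 : strdec 0 = [::].
Proof. by apply: strcode_inj; rewrite strdecK. Qed.

(** Prepending a digit doubles the code and adds 1 or 2, which terms can express. *)
Lemma strdec_false n : strdec (n + n).+1 = false :: strdec n.
Proof.
by apply: strcode_inj; rewrite strdecK /= -/(strcode _) strdecK addnn addn1.
Qed.

Lemma strdec_true n : strdec (n + n).+2 = true :: strdec n.
Proof.
by apply: strcode_inj; rewrite strdecK /= -/(strcode _) strdecK addnn addn2.
Qed.

(** * Arithmetical predicates and their formulas *)

Definition arith (P : set nat -> (nat -> nat) -> Prop) :=
  exists f, forall Y v, holds Y v f <-> P Y (nth 0 v).

Definition arith_term (g : (nat -> nat) -> nat) :=
  exists t, forall v, teval v t = g (nth 0 v).

Section Arith.
Implicit Types (P Q : set nat -> (nat -> nat) -> Prop).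
Implicit Types (g h : (nat -> nat) -> nat).

Lemma arith_var i : arith_term (fun r => r i).
Proof. by exists (TVar i). Qed.

Lemma arith_zero : arith_term (fun=> 0).
Proof. by exists TZero. Qed.

Lemma arith_succ g : arith_term g -> arith_term (fun r => (g r).+1).
Proof. by case=> t Et; exists (TSucc t) => v /=; rewrite Et. Qed.

Lemma arith_add g h : arith_term g -> arith_term h ->
  arith_term (fun r => g r + h r).
Proof. by case=> t Et [u Eu]; exists (TAdd t u) => v /=; rewrite Et Eu. Qed.

Lemma arith_mul g h : arith_term g -> arith_term h ->
  arith_term (fun r => g r * h r).
Proof. by case=> t Et [u Eu]; exists (TMul t u) => v /=; rewrite Et Eu. Qed.

Lemma arith_enc_nil : arith_term (fun=> enc [::]).
Proof. exact: arith_zero. Qed.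

Lemma arith_npair g h : arith_term g -> arith_term h ->
  arith_term (fun r => npair (g r) (h r)).
Proof.
move=> Ag Ah; have Agh := arith_add Ag Ah.
by have [t Et] := arith_add (arith_add (arith_mul Agh Agh) Ag)
  (arith_succ arith_zero); exists t.
Qed.

Lemma arith_enc_cons g (l : (nat -> nat) -> seq nat) : arith_term g ->
  arith_term (fun r => enc (l r)) -> arith_term (fun r => enc (g r :: l r)).
Proof. exact: arith_npair. Qed.

Lemma arith_mem g : arith_term g -> arith (fun Y r => Y (g r)).
Proof. by case=> t Et; exists (FMem t) => Y v /=; rewrite Et. Qed.

Lemma arith_eq g h : arith_term g -> arith_term h ->
  arith (fun Y r => g r = h r).
Proof. by case=> t Et [u Eu]; exists (FEq t u) => Y v /=; rewrite Et Eu. Qed.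

Lemma arith_not P : arith P -> arith (fun Y r => ~ P Y r).
Proof. by case=> f Ef; exists (FNot f) => Y v /=; rewrite Ef. Qed.

Lemma arith_and P Q : arith P -> arith Q -> arith (fun Y r => P Y r /\ Q Y r).
Proof. by case=> f Ef [g Eg]; exists (FAnd f g) => Y v /=; rewrite Ef Eg. Qed.

Lemma arith_imp P Q : arith P -> arith Q -> arith (fun Y r => P Y r -> Q Y r).
Proof.
case=> f Ef [g Eg]; exists (FNot (FAnd f (FNot g))) => Y v /=; rewrite Ef Eg.
split=> [nPQ HP|PQ [HP nQ]]; last exact: nQ (PQ HP).
by apply: contrapT => nQ; apply: nPQ.
Qed.

Lemma arith_all (P : set nat -> (nat -> nat) -> nat -> Prop) :
  arith (fun Y r => P Y (fun i => r i.+1) (r 0)) ->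
  arith (fun Y r => forall n, P Y r n).
Proof.
case=> f Ef; exists (FAll f) => Y v /=.
by split=> H n; [apply: (Ef Y (n :: v)).1 | apply/(Ef Y (n :: v)).2]; apply: H.
Qed.

End Arith.

(** * Rules for truth and covers *)

(* The sets [Y] below contain codes of facts, headed by a tag:
   0 [i n]: [n] is in the base set [Z_i];
   1 [t v n]: the term [t] has the value [n] in the environment [v];
   2, 3 [i f v]: the formula [f] is true, false at [Z_i] in [v];
   4, 5 [a b]: the string [a] is a prefix, lexicographically to the left, of [b];
   6 [c a b]: incrementing [a] gives [b] with carry [c];
   7 [a b k]: [a] is a string of [m] zeros, [b = budget m] and [k = 2 ^ m];
   8 [e a b]: the budget [b] is [a] with the entry [e] decremented;
   9 [t s b]: [covers] holds of [s] and [b], relative to the oracle prefix [t];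
   10 [t u]: the string [u] is in the left cut, relative to [t].
   Truth and falsity are generated by separate rules, all of which but the one
   for the base sets are positive; the empty environment is coded by [0], and
   environments are recognized by the value of the term [0] in them. *)
Definition closed_val (Y : set nat) : Prop :=
  (forall i, Y (enc [:: 1; enc [:: 0; i]; 0; 0])) /\
  (forall x v, Y (enc [:: 1; enc [:: 1]; v; 0]) ->
    Y (enc [:: 1; enc [:: 0; 0]; npair x v; x])) /\
  (forall i x v n, Y (enc [:: 1; enc [:: 0; i]; v; n]) ->
    Y (enc [:: 1; enc [:: 0; i.+1]; npair x v; n])) /\
  Y (enc [:: 1; enc [:: 1]; 0; 0]) /\
  (forall x v, Y (enc [:: 1; enc [:: 1]; v; 0]) ->
    Y (enc [:: 1; enc [:: 1]; npair x v; 0])) /\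
  (forall t v n, Y (enc [:: 1; t; v; n]) ->
    Y (enc [:: 1; enc [:: 2; t]; v; n.+1])) /\
  (forall t u v n m, Y (enc [:: 1; t; v; n]) -> Y (enc [:: 1; u; v; m]) ->
    Y (enc [:: 1; enc [:: 3; t; u]; v; n + m])) /\
  (forall t u v n m, Y (enc [:: 1; t; v; n]) -> Y (enc [:: 1; u; v; m]) ->
    Y (enc [:: 1; enc [:: 4; t; u]; v; n * m])).

(** Falsity of a conjunction has a rule for each of its three cases, so that every derivation checks
    both conjuncts to be codes of formulas. *)
Definition closed_sat (Y : set nat) : Prop :=
  (forall i t u v n, Y (enc [:: 1; t; v; n]) -> Y (enc [:: 1; u; v; n]) ->
    Y (enc [:: 2; i; enc [:: 0; t; u]; v])) /\
  (forall i t u v n m, Y (enc [:: 1; t; v; n]) -> Y (enc [:: 1; u; v; m]) ->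
    ~ n = m -> Y (enc [:: 3; i; enc [:: 0; t; u]; v])) /\
  (forall i t v n, Y (enc [:: 1; t; v; n]) -> Y (enc [:: 0; i; n]) ->
    Y (enc [:: 2; i; enc [:: 1; t]; v])) /\
  (forall i t v n, Y (enc [:: 1; t; v; n]) -> ~ Y (enc [:: 0; i; n]) ->
    Y (enc [:: 3; i; enc [:: 1; t]; v])) /\
  (forall i f v, Y (enc [:: 3; i; f; v]) -> Y (enc [:: 2; i; enc [:: 2; f]; v])) /\
  (forall i f v, Y (enc [:: 2; i; f; v]) -> Y (enc [:: 3; i; enc [:: 2; f]; v])) /\
  (forall i f g v, Y (enc [:: 2; i; f; v]) -> Y (enc [:: 2; i; g; v]) ->
    Y (enc [:: 2; i; enc [:: 3; f; g]; v])) /\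
  (forall i f g v, Y (enc [:: 3; i; f; v]) -> Y (enc [:: 2; i; g; v]) ->
    Y (enc [:: 3; i; enc [:: 3; f; g]; v])) /\
  (forall i f g v, Y (enc [:: 2; i; f; v]) -> Y (enc [:: 3; i; g; v]) ->
    Y (enc [:: 3; i; enc [:: 3; f; g]; v])) /\
  (forall i f g v, Y (enc [:: 3; i; f; v]) -> Y (enc [:: 3; i; g; v]) ->
    Y (enc [:: 3; i; enc [:: 3; f; g]; v])) /\
  (forall i f v, (forall x, Y (enc [:: 2; i; f; npair x v])) ->
    Y (enc [:: 2; i; enc [:: 4; f]; v])) /\
  (forall i f v x, Y (enc [:: 3; i; f; npair x v]) ->
    Y (enc [:: 3; i; enc [:: 4; f]; v])).

Definition closed_str (Y : set nat) : Prop :=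
  (forall b, Y (enc [:: 4; 0; b])) /\
  (forall a b, Y (enc [:: 4; a; b]) -> Y (enc [:: 4; (a + a).+1; (b + b).+1])) /\
  (forall a b, Y (enc [:: 4; a; b]) -> Y (enc [:: 4; (a + a).+2; (b + b).+2])) /\
  (forall a b, Y (enc [:: 5; (a + a).+1; (b + b).+2])) /\
  (forall a b, Y (enc [:: 5; a; b]) -> Y (enc [:: 5; (a + a).+1; (b + b).+1])) /\
  (forall a b, Y (enc [:: 5; a; b]) -> Y (enc [:: 5; (a + a).+2; (b + b).+2])) /\
  Y (enc [:: 6; 1; 0; 0]) /\
  (forall a b, Y (enc [:: 6; 1; a; b]) ->
    Y (enc [:: 6; 1; (a + a).+2; (b + b).+1])) /\
  (forall a b, Y (enc [:: 6; 1; a; b]) ->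
    Y (enc [:: 6; 0; (a + a).+1; (b + b).+2])) /\
  (forall a b, Y (enc [:: 6; 0; a; b]) ->
    Y (enc [:: 6; 0; (a + a).+1; (b + b).+1])) /\
  (forall a b, Y (enc [:: 6; 0; a; b]) ->
    Y (enc [:: 6; 0; (a + a).+2; (b + b).+2])).

(** Tag 7 carries [2 ^ m] along because exponentiation is not a term. In the claim rule the base set
    is indexed by formula and environment together, so that distinct instances have separate base
    sets. *)
Definition closed_covers (Y : set nat) : Prop :=
  Y (enc [:: 7; 0; 0; 1]) /\
  (forall a b k, Y (enc [:: 7; a; b; k]) ->
    Y (enc [:: 7; (a + a).+1; npair k b; k + k])) /\
  (forall x b, Y (enc [:: 8; 0; npair x.+1 b; npair x b])) /\
  (forall e x a b, Y (enc [:: 8; e; a; b]) ->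
    Y (enc [:: 8; e.+1; npair x a; npair x b])) /\
  (forall t s b k, Y (enc [:: 7; s; b; k]) -> Y (enc [:: 9; t; s; b])) /\
  (forall t s s' b b' e a r, Y (enc [:: 9; t; s; b]) -> Y (enc [:: 6; 0; s; s']) ->
    Y (enc [:: 8; e; b; b']) -> Y (enc [:: 4; a; t]) -> Y (enc [:: 4; r; s]) ->
    Y (enc [:: 2; npair e (enc [:: e.+1; a; r]); e; enc [:: e.+1; a; r]]) ->
    Y (enc [:: 9; t; s'; b'])) /\
  (forall t s b u, Y (enc [:: 9; t; s; b]) -> Y (enc [:: 5; u; s]) ->
    Y (enc [:: 10; t; u])).

(** Builds the formula by recursion on the shape of the predicate; [r i] stands for the variable
    with index [i]. *)
Ltac arith :=
  cbv beta;
  lazymatch goal with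
  | |- arith_term (fun r => r ?i) => exact (arith_var i)
  | |- arith_term (fun r => 0) => exact arith_zero
  | |- arith_term (fun r => enc nil) => exact arith_enc_nil
  | |- arith_term (fun r => S (@?g r)) => refine (@arith_succ g _); arith
  | |- arith_term (fun r => enc (cons (@?g r) (@?l r))) =>
      refine (@arith_enc_cons g l _ _); arith
  | |- arith_term (fun r => npair (@?g r) (@?h r)) =>
      refine (@arith_npair g h _ _); arith
  | |- arith_term (fun r => addn (@?g r) (@?h r)) =>
      refine (@arith_add g h _ _); arith
  | |- arith_term (fun r => muln (@?g r) (@?h r)) =>
      refine (@arith_mul g h _ _); arith
  | |- arith (fun Y r => and (@?P Y r) (@?Q Y r)) =>
      refine (@arith_and P Q _ _); arith
  | |- arith (fun Y r => not (@?P Y r)) => refine (@arith_not P _); arith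
  | |- arith (fun Y r => @eq nat (@?g r) (@?h r)) =>
      refine (@arith_eq g h _ _); arith
  | |- arith (fun Y r => Y (@?g r)) => refine (@arith_mem g _); arith
  | |- arith (fun Y r => forall n : nat, @?P Y r n) =>
      refine (@arith_all P _); arith
  | |- arith (fun Y r => (@?P Y r) -> (@?Q Y r)) =>
      refine (@arith_imp P Q _ _); arith
  end.

(** * Facts contained in every closed set *)

Definition valid e v := exists2 f, e = fcode f & forall Z, holds Z v f.

(** [T] will be [valid] or truth at chosen base sets. The environment is [code3] of a triple in
    component [e + 1]; the prefixes make the relation monotone in both strings. *)
Definition oracle (T : nat -> seq nat -> Prop) (t : seq bool) e (s : seq bool)
    : Prop :=
  exists a b, [/\ prefix a t, prefix b s & T e [:: e.+1; strcode a; strcode b]].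

Definition left_of_cover (T : nat -> seq nat -> Prop) (t u : seq bool) :=
  exists s B, covers (oracle T t) s B /\ lexlt u s.

Section ClosedContains.
Variable Y : set nat.
Hypotheses (Yval : closed_val Y) (Ysat : closed_sat Y) (Ystr : closed_str Y)
  (Ycov : closed_covers Y).

Lemma closed_teval t v : Y (enc [:: 1; tcode t; enc v; teval v t]).
Proof.
have [H1 [H2 [H3 [H4 [H5 [H6 [H7 H8]]]]]]] := Yval.
have Henv w : Y (enc [:: 1; enc [:: 1]; enc w; 0]).
  by elim: w => [|x w IH]; [apply: H4 | rewrite (enc_cons x w); apply: H5].
elim: t => [i||t IHt|t IHt u IHu|t IHt u IHu] /=.
- elim: v i => [|x v IH] [|i] /=; try exact: H1; rewrite (enc_cons x v).
    exact: H2.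
  exact: H3.
- exact: Henv.
- exact: H6.
- exact: H7.
- exact: H8.
Qed.

(** The base set is read off [Y] itself, which settles the atomic formulas; negation forces truth
    and falsity into one induction. *)
Lemma closed_holds i f v :
  if `[< holds [set n | Y (enc [:: 0; i; n])] v f >]
  then Y (enc [:: 2; i; fcode f; enc v]) else Y (enc [:: 3; i; fcode f; enc v]).
Proof.
have [H1 [H2 [H3 [H4 [H5 [H6 [H7 [H8 [H9 [H10 [H11 H12]]]]]]]]]]] := Ysat.
set Z := [set n | _].
elim: f v => [t u|t|f IHf|f IHf g IHg|f IHf] v /=.
- case: asboolP => eq_tu; last by apply: H2 eq_tu; apply: closed_teval.
  apply: (H1 _ _ _ _ (teval v t)); first exact: closed_teval.
  by rewrite eq_tu; apply: closed_teval.
- case: asboolP => Zt.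
    by apply: H3 Zt; apply: closed_teval.
  by apply: H4 Zt; apply: closed_teval.
- rewrite asbool_neg; move: (IHf v); case: asboolP => /= _.
    exact: H6.
  exact: H5.
- rewrite asbool_and; move: (IHf v) (IHg v).
  case: asboolP => _; case: asboolP => _ /=.
  + exact: H7.
  + exact: H9.
  + exact: H8.
  + exact: H10.
- case: asboolP => [Hf|/existsNP[x nHf]].
    apply: H11 => x; rewrite -enc_cons; move: (IHf (x :: v)).
    by case: asboolP => // /(_ (Hf x)).
  apply: (H12 _ _ _ x); rewrite -enc_cons; move: (IHf (x :: v)).
  by case: asboolP.
Qed.

Lemma closed_prefix s t : prefix s t -> Y (enc [:: 4; strcode s; strcode t]).
Proof.
have [H1 [H2 [H3 _]]] := Ystr.
elim: s t => [|b s IH] [|c t] //=; try by move=> _; apply: H1.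
case/andP=> /eqP<- /IH Yst; rewrite -!addnn.
by case: b; rewrite ?addn1 ?addn2; [apply: H3|apply: H2].
Qed.

Lemma closed_lexlt s t : lexlt s t -> Y (enc [:: 5; strcode s; strcode t]).
Proof.
have [_ [_ [_ [H1 [H2 [H3 _]]]]]] := Ystr.
elim: s t => [|b s IH] [|c t] //=; rewrite -!addnn.
by case: b c => [] [] //=; rewrite ?addn1 ?addn2 => ?;
  [apply: H3; apply: IH | apply: H1 | apply: H2; apply: IH].
Qed.

Lemma closed_incr s :
  Y (enc [:: 6; (incr s).1 : nat; strcode s; strcode (incr s).2]).
Proof.
have [_ [_ [_ [_ [_ [_ [H1 [H2 [H3 [H4 H5]]]]]]]]]] := Ystr.
elim: s => [|b s] /=; first exact: H1.
case: (incr s) => [[] t] /=; rewrite -!addnn; case: b => /=;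
  rewrite ?addn1 ?addn2;
  [exact: H2|exact: H3|exact: H5|exact: H4].
Qed.

Lemma closed_budget m :
  Y (enc [:: 7; strcode (nseq m false); enc (budget m); 2 ^ m]).
Proof.
have [H1 [H2 _]] := Ycov; elim: m => [|m IH] /=; first exact: H1.
by rewrite (enc_cons _ (budget _)) -addnn addn1 expnS mul2n -addnn; apply: H2.
Qed.

Lemma closed_incr_nth e B : e < size B ->
  Y (enc [:: 8; e; enc (incr_nth B e); enc B]).
Proof.
have [_ [_ [H1 [H2 _]]]] := Ycov.
elim: e B => [|e IH] [|x B] //= eB.
  by rewrite !(enc_cons _ B); apply: H1.
by rewrite (enc_cons _ B) (enc_cons _ (incr_nth _ _)); apply: H2; apply: IH.
Qed.

Lemma closed_left_of_cover t u : left_of_cover valid t u ->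
  Y (enc [:: 10; strcode t; strcode u]).
Proof.
have [_ [_ [_ [_ [H1 [H2 H3]]]]]] := Ycov.
case=> s [B [cov /closed_lexlt Yus]]; apply: (H3 _ _ (enc B)) Yus.
elim: cov => [m|{}s s' {}B e _ IH eB [a [b [pat pbs val_e]]] s_s'].
  by apply: (H1 _ _ _ (2 ^ m)); apply: closed_budget.
apply: (H2 _ _ _ _ _ e (strcode a) (strcode b) IH).
- by have := closed_incr s; rewrite s_s'.
- exact: closed_incr_nth.
- exact: closed_prefix.
- exact: closed_prefix.
- have [f -> val_f] := val_e.
  set v := [:: _.+1; _; _].
  (* A valid formula holds in particular at the base set which [Y] supplies for this instance. *)
  have := closed_holds (npair (fcode f) (enc v)) f v.
  by rewrite asboolT//; apply: val_f.
Qed.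
End ClosedContains.

(** * A closed set with prescribed base sets *)

Section MinimalModel.
Variable Z : nat -> set nat.

Definition sat_at e v :=
  exists2 f, e = fcode f & holds (Z (npair e (enc v))) v f.

(* Tag 8 is read universally because its first rule concerns arbitrary numbers,
   not only codes of lists. *)
Definition fact (l : seq nat) : Prop :=
  match l with
  | [:: 0; i; n] => Z i n
  | [:: 1; c; x; n] =>
      exists t v, [/\ c = tcode t, x = enc v & n = teval v t]
  | [:: 2; i; c; x] => exists f v, [/\ c = fcode f, x = enc v & holds (Z i) v f]
  | [:: 3; i; c; x] =>
      exists f v, [/\ c = fcode f, x = enc v & ~ holds (Z i) v f]
  | [:: 4; a; b] => prefix (strdec a) (strdec b)
  | [:: 5; a; b] => lexlt (strdec a) (strdec b)
  | [:: 6; c; a; b] => incr (strdec a) = (c == 1, strdec b)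
  | [:: 7; a; b; k] =>
      exists m, [/\ strdec a = nseq m false, b = enc (budget m) & k = 2 ^ m]
  | [:: 8; e; a; b] => forall B, a = enc B ->
      exists B', [/\ b = enc B', e < size B' & B = incr_nth B' e]
  | [:: 9; t; s; b] =>
      exists2 B, b = enc B & covers (oracle sat_at (strdec t)) (strdec s) B
  | [:: 10; t; u] => left_of_cover sat_at (strdec t) (strdec u)
  | _ => False
  end.

Definition fact_set : set nat := [set n | exists2 l, n = enc l & fact l].

Lemma fact_setE l : fact_set (enc l) = fact l.
Proof.
by apply/propext; split=> [[k /enc_inj<-]//|]; exists l.
Qed.

Lemma fact_closed_val : closed_val fact_set.
Proof.
rewrite /closed_val; do !split.
- move=> i; rewrite fact_setE; exists (TVar i), [::].
  by split=> //=; rewrite nth_nil.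
- move=> x v; rewrite !fact_setE => -[_ [w [_ -> _]]].
  by exists (TVar 0), (x :: w).
- move=> i x v n; rewrite !fact_setE => -[t [w [eqt -> ->]]].
  case: t eqt => [j||?|? ?|? ?] /enc_inj //= [->].
  by exists (TVar j.+1), (x :: w).
- by rewrite fact_setE; exists TZero, [::].
- move=> x v; rewrite !fact_setE => -[_ [w [_ -> _]]].
  by exists TZero, (x :: w).
- move=> t v n; rewrite !fact_setE => -[t' [w [-> -> ->]]].
  by exists (TSucc t'), w.
- move=> t u v n m; rewrite !fact_setE.
  move=> [t' [w [-> -> ->]]] [u' [_ [-> /enc_inj<- ->]]].
  by exists (TAdd t' u'), w.
- move=> t u v n m; rewrite !fact_setE.
  move=> [t' [w [-> -> ->]]] [u' [_ [-> /enc_inj<- ->]]].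
  by exists (TMul t' u'), w.
Qed.

Lemma fact_closed_sat : closed_sat fact_set.
Proof.
rewrite /closed_sat; do !split.
- move=> i t u v n; rewrite !fact_setE.
  move=> [t' [w [-> -> eqt]]] [u' [_ [-> /enc_inj<- equ]]].
  by exists (FEq t' u'), w; split=> //=; rewrite -eqt.
- move=> i t u v n m; rewrite !fact_setE.
  move=> [t' [w [-> -> ->]]] [u' [_ [-> /enc_inj<- ->]]] neq.
  by exists (FEq t' u'), w.
- move=> i t v n; rewrite !fact_setE => -[t' [w [-> -> ->]]] Zt.
  by exists (FMem t'), w.
- move=> i t v n; rewrite !fact_setE => -[t' [w [-> -> ->]]] Zt.
  by exists (FMem t'), w.
- move=> i f v; rewrite !fact_setE => -[f' [w [-> -> Hf]]].
  by exists (FNot f'), w.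
- move=> i f v; rewrite !fact_setE => -[f' [w [-> -> Hf]]].
  by exists (FNot f'), w; split=> // /(_ Hf).
- move=> i f g v; rewrite !fact_setE.
  move=> [f' [w [-> -> Hf]]] [g' [_ [-> /enc_inj<- Hg]]].
  by exists (FAnd f' g'), w.
- move=> i f g v; rewrite !fact_setE.
  move=> [f' [w [-> -> Hf]]] [g' [_ [-> /enc_inj<- Hg]]].
  by exists (FAnd f' g'), w; split=> // -[].
- move=> i f g v; rewrite !fact_setE.
  move=> [f' [w [-> -> Hf]]] [g' [_ [-> /enc_inj<- Hg]]].
  by exists (FAnd f' g'), w; split=> // -[].
- move=> i f g v; rewrite !fact_setE.
  move=> [f' [w [-> -> Hf]]] [g' [_ [-> /enc_inj<- Hg]]].
  by exists (FAnd f' g'), w; split=> // -[].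
- move=> i f v Hf; rewrite !fact_setE.
  (* The premise at [0] supplies the formula and the environment; injectivity of the codes
     identifies them in the other premises. *)
  have := Hf 0; rewrite fact_setE => -[f' [_ [eqf /npair_enc[w -> eqv] _]]].
  exists (FAll f'), w; split=> //=; first by rewrite eqf.
  move=> x; have := Hf x; rewrite eqf eqv -enc_cons fact_setE.
  by move=> [g [u [/fcode_inj<- /enc_inj<-]]].
- move=> i f v x; rewrite !fact_setE => -[f' [_ [-> /npair_enc[w -> ->] nf]]].
  exists (FAll f'), w; split=> //= /(_ x); exact: nf.
Qed.

Lemma fact_closed_str : closed_str fact_set.
Proof.
rewrite /closed_str; do !split; [move=> b | move=> a b | move=> a b
  | move=> a b | move=> a b | move=> a b | | move=> a b | move=> a b
  | move=> a b | move=> a b ]; rewrite !fact_setE /=;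
  by rewrite ?strdec_false ?strdec_true ?strdec0 ?prefix0s //= => ->.
Qed.

Lemma fact_closed_covers : closed_covers fact_set.
Proof.
rewrite /closed_covers; do !split.
- by rewrite fact_setE; exists 0; rewrite strdec0.
- move=> a b k; rewrite !fact_setE => -[m [eqa -> ->]].
  by exists m.+1; rewrite strdec_false eqa expnS mul2n -addnn.
- move=> x b; rewrite fact_setE => _ /npair_enc[B -> ->].
  by exists (x :: B).
- move=> e x a b; rewrite !fact_setE => Hab _ /npair_enc[B -> /Hab].
  by case=> B' [-> eB ->]; exists (x :: B').
- move=> t s b k; rewrite !fact_setE => -[m [eqs -> _]].
  exists (budget m) => //; rewrite eqs; exact: covers_nil.
- move=> t s s' b b' e a r; rewrite !fact_setE.
  move=> [B -> cov] incr_s /(_ B erefl)[B' [-> eB eqB]] pre_a pre_r.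
  move=> [f [v [eqe /enc_inj eqv Hf]]]; exists B' => //.
  apply: (@covers_step _ (strdec s) _ _ e) => //; first by rewrite -eqB.
  exists (strdec a), (strdec r); split=> //; rewrite !strdecK.
  by exists f => //; move: Hf; rewrite -eqv.
- move=> t s b u; rewrite !fact_setE => -[B _ cov] lt_us.
  by exists (strdec s), B.
Qed.
End MinimalModel.

(** * The left cut as a Pi^1_1 set *)

Lemma covers_mono (O O' : nat -> seq bool -> Prop) s B :
  (forall e r, O e r -> O' e r) -> covers O s B -> covers O' s B.
Proof.
move=> OO'; elim=> [m|{}s t {}B e _ IH eB Os s_t]; first exact: covers_nil.
by apply: covers_step IH eB _ s_t; apply: OO'.
Qed.

Definition left_set : set (seq bool * seq bool) :=
  [set p | left_of_cover valid p.1 p.2].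

(** Valid instances are true at the base sets of any closed [Y]. Conversely, for base sets that
    refute every invalid instance, truth in [fact_set] amounts to validity. *)
Lemma pi11_left_set : pi11 code2 left_set.
Proof.
have [f Hf] : arith (fun Y r => (closed_val Y /\ closed_sat Y) /\
    (closed_str Y /\ closed_covers Y) -> Y (enc [:: 10; r 0; r 1])).
  by unfold closed_val, closed_sat, closed_str, closed_covers; arith.
exists f => -[t u]; split=> [left_tu Y|Hall].
  apply/Hf => -[[Yval Ysat] [Ystr Ycov]] /=; exact: closed_left_of_cover.
(* [Z i] is to refute the instance coded by [i] if any set does. *)
pose decides i (X : set nat) := forall f v,
  i = npair (fcode f) (enc v) -> holds X v f -> forall X', holds X' v f.
have /choice[Z HZ] : forall i, exists X, decides i X.
  move=> i; rewrite /decides.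
  have [[X [g [w [-> ng]]]]|noX] := pselect (exists X g w,
      i = npair (fcode g) (enc w) /\ ~ holds X w g).
    exists X => h v /npair_inj[/fcode_inj<- /enc_inj<-] //.
  exists set0 => h v eq_i _ X; apply: contrapT => nh; apply: noX.
  by exists X, h, v.
have := (Hf (fact_set Z) (code2 (t, u))).1 (Hall _).
rewrite /= fact_setE /= !strcodeK => -[].
  split; split; [exact: fact_closed_val | exact: fact_closed_sat
    | exact: fact_closed_str | exact: fact_closed_covers].
move=> s [B [cov lt_us]]; exists s, B; split=> //.
apply: covers_mono cov => e r [a [b [pat pbr [g eqe Hg]]]].
exists a, b; split=> //; exists g => //; apply: (HZ _ _ _ _ Hg).
by rewrite eqe.
Qed.

(** * Passage to the whole oracle and conclusion *)

Lemma oracle_rcons T t e s b : oracle T t e s -> oracle T t e (rcons s b).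
Proof.
case=> a [r [pat prs Te]]; exists a, r; split=> //.
exact: prefix_trans prs (prefix_rcons _ _).
Qed.

Lemma init_segP s (X : cantor_space) : init_seg s X -> forall t,
  init_seg t X -> size s <= size t -> prefix s t.
Proof.
move=> -> t -> ; rewrite !size_mkseq => le_st.
by rewrite /mkseq -(subnKC le_st) iotaD map_cat prefix_prefix.
Qed.

Definition limit_oracle (A : cantor_space) e s :=
  exists t, init_seg t A /\ oracle valid t e s.

(** A derivation of [covers] makes finitely many claims, so the longest initial segment of [A] among
    those they use serves for all. *)
Lemma relativize_left_set (A : cantor_space) u :
  relativize left_set A u <->
  exists2 s, (exists B, covers (limit_oracle A) s B) & lexlt u s.
Proof.
split=> [[t [tA [s [B [cov lt_us]]]]]|[s [B cov] lt_us]].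
  exists s => //; exists B; apply: covers_mono cov => e r Or; by exists t.
suff [t tA cov_t] : exists2 t, init_seg t A & covers (oracle valid t) s B.
  by exists t; split=> //; exists s, B.
have mono t t' : init_seg t A -> init_seg t' A -> size t <= size t' ->
    forall e r, oracle valid t e r -> oracle valid t' e r.
  move=> tA t'A le e r [a [b [pat pbr ?]]]; exists a, b; split=> //.
  exact: prefix_trans pat (init_segP tA t'A le).
elim: cov => [m|{}s {lt_us}s' {}B e _ [t tA cov] eB [t' [t'A Oe]] s_s'].
  by exists [::] => //; apply: covers_nil.
have [le|/ltnW le] := leqP (size t) (size t').
  exists t' => //; apply: covers_step eB Oe s_s'.
  by apply: covers_mono cov; apply: mono.
exists t => //; apply: covers_step eB _ s_s'; first exact: cov.
exact: (mono t').
Qed.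

Theorem theorem5p6 (R : realType) :
  (forall A : cantor_space, exists X : cantor_space,
     higher_left_ce A X /\ higher_ML_random R A X) /\
  (exists W : set (seq bool * seq bool), pi11 code2 W /\
     forall A : cantor_space, exists X : cantor_space,
       higher_ML_random R A X /\
       relativize W A = [set s : seq bool | lex_left s X]).
Proof.
suff main A : exists X : cantor_space, higher_ML_random R A X /\
    relativize left_set A = [set s | lex_left s X].
  split=> [A|]; last by exists left_set; split=> //; exact: pi11_left_set.
  have [X [ranX eqX]] := main A; exists X; split=> //.
  by exists left_set; rewrite eqX; split=> //; exact: pi11_left_set.
pose X := lex_sup [set s | exists B, covers (limit_oracle A) s B].
exists X; split; last first.
  apply/seteqP; split=> u /=; rewrite lex_left_sup.
    by move/relativize_left_set.
  by move=> Cu; apply/relativize_left_set.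
move=> U [[V [[f Hf] UV]] leU] capX.
(* With [e = fcode f], the measure bound of component [e + 1] matches the share of each level that
   index [e] may claim. *)
pose n := (fcode f).+1.
have : U n X by apply: capX.
rewrite UV => -[r [rX [t [tA Vtr]]]].
have val_f a b : V (n, (a, b)) <-> valid (fcode f) [:: n; strcode a; strcode b].
  split=> [/Hf|[g /fcode_inj<- Hg]]; first by exists f.
  by apply/Hf.
have lim e s b : limit_oracle A e s -> limit_oracle A e (rcons s b).
  by move=> [t' [t'A Oe]]; exists t'; split=> //; apply: oracle_rcons.
apply: (@lex_sup_avoids (limit_oracle A) lim (fcode f) (size r)).
  (* Strings that the index may claim have their cylinders inside [U n], so the measure bound limits
     their number. *)
  move=> m D uD HD.
  apply: (fair_coin_count (leU n) uD (fun t' t'D => (HD t' t'D).1)).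
  move=> Y [s [sY /= /HD[_ [t' [t'A [a [b [pat' pbs vab]]]]]]]].
  have Vab := (val_f a b).2 vab.
  rewrite UV; exists b; split.
    move: pbs => /prefixP[s' eq_s]; move: sY; rewrite /init_seg eq_s size_cat.
    rewrite /mkseq iotaD map_cat => /eqP.
    by rewrite eqseq_cat ?size_map ?size_iota// => /andP[/eqP].
  exists a; split=> //; move: pat' t'A => /prefixP[s' ->].
  rewrite /init_seg size_cat /mkseq iotaD map_cat => /eqP.
  by rewrite eqseq_cat ?size_map ?size_iota// => /andP[/eqP].
rewrite -rX; exists t; split=> //; exists t, r.
split; [exact: prefix_refl | exact: prefix_refl | exact/val_f].
Qed.
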